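(* Let the standing assumptions (listed in the context) hold. Then: 1) If Algorithm SLBFGS is applied with $\epsilon=0$, then it either terminates after finitely many iterations with an $x_k$ that satisfies $\nabla\mathcal{J}(x_k)=0$ or it generates a sequence $(x_k)$ such that $\lim_{k\to\infty}\|\nabla\mathcal{J}(x_k)\| = 0$. In particular, every cluster point of $(x_k)$ is stationary. 2) If Algorithm SLBFGS is applied with $\epsilon>0$, then it terminates after finitely many iterations with an $x_k$ that satisfies $\|\nabla\mathcal{J}(x_k)\|\leq\epsilon$.
   Context: Let $\mathcal{X}$ be a Hilbert space and $\mathcal{J}:\mathcal{X}\to\mathbb{R}$. Algorithm SLBFGS (structured inverse L-BFGS): inputs $x_0\in\mathcal{X}$, $\epsilon\geq0$, $\ell\in\mathbb{N}_0$, $c_0\geq 0$, $C_0\in[c_0,\infty]$, $c_s,c_1,c_2>0$; let $\tau_0>0$. For $k=0,1,2,\ldots$: let $m=\max\{0,k-\ell\}$; choose a symmetric positive semi-definite bounded linear operator $S_k$; set $B_k^{(0)}=\tau_k I+S_k$; let $B_k$ be obtained from $B_k^{(0)}$ and the currently stored pairs $(s_j,y_j)$, $m\le j\le k-1$, by successive L-BFGS updates $B\mapsto B+\frac{yy^T}{y^Ts}-\frac{Bss^TB}{s^TBs}$; set $d_k=-B_k^{-1}\nabla\mathcal{J}(x_k)$; compute a step length $\alpha_k>0$ by a line search; set $s_k=\alpha_kd_k$, $x_{k+1}=x_k+s_k$, $y_k=\nabla\mathcal{J}(x_{k+1})-\nabla\mathcal{J}(x_k)$; store $(s_k,y_k)$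 only if $y_k^Ts_k>c_s\|s_k\|^2$; if $k\ge\ell$ remove $(s_m,y_m)$ from storage; stop with output $x_{k+1}$ if $\|\nabla\mathcal{J}(x_{k+1})\|\le\epsilon$; set $z_k=y_k-S_{k+1}s_k$, $\omega^l_{k+1}=\min\{c_0,c_1\|\nabla\mathcal{J}(x_{k+1})\|^{c_2}\}$, $\omega^u_{k+1}=\max\{C_0,(c_1\|\nabla\mathcal{J}(x_{k+1})\|^{c_2})^{-1}\}$; with $P(t)=\min\{\max\{t,\omega^l_{k+1}\},\omega^u_{k+1}\}$ and $\rho=z_k^Ts_k$ let $\tau^s=P(\rho/\|s_k\|^2)$, $\tau^g=P(\|z_k\|/\|s_k\|)$, $\tau^z=P(\|z_k\|^2/\rho)$; if $\rho>0$ choose $\tau_{k+1}\in[\tau^s,\tau^z]$, else choose $\tau_{k+1}\in[\tau^s,\tau^g]$. Line searches: Armijo with backtracking means, for fixed $\beta,\sigma\in(0,1)$, $\alpha_k$ is the largest number in $\{1,\beta,\beta^2,\ldots\}$ with $\mathcal{J}(x_{k+1})\le\mathcal{J}(x_k)+\alpha_k\sigma\nabla\mathcal{J}(x_k)^Td_k$; the Wolfe–Powell conditions are this Armijo inequality together with $\nabla\mathcal{J}(x_{k+1})^Td_k\ge\eta\nabla\mathcal{J}(x_k)^Td_k$ for fixed $\eta\in(\sigma,1)$. Let $\Omega=\{x:\mathcal{J}(x)\le\mathcal{J}(x_0)\}$ and $\Omega_\delta=\{x:\exists\hat x\in\Omega,\ \|x-\hat x\|<\delta\}$. Standing assumptions: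 1) $\mathcal{J}$ is continuously differentiable and bounded below; 2) $\nabla\mathcal{J}$ is Lipschitz continuous on $\Omega$ with constant $L>0$; 3) $(\|S_k\|)$ is bounded; 4) the step sizes consistently satisfy the Armijo condition computed by backtracking, or consistently satisfy the Wolfe–Powell conditions; in the Armijo case there is $\delta>0$ such that $\mathcal{J}$ or $\nabla\mathcal{J}$ is uniformly continuous on $\Omega_\delta$; 5) $c_0=0$ is only chosen if then $\sup_k\|(B_k^{(0)})^{-1}\|<\infty$; 6) $C_0=\infty$ is only chosen if either the interval $[\tau^s,\tau^z]$ is replaced by $[\tau^s,\tau^g]$, or $\mathcal{J}$ is twice continuously differentiable, $\overline{G_k}:=\int_0^1\nabla^2\mathcal{J}(x_k+ts_k)\,dt-S_{k+1}$ is symmetric positive semi-definite for all $k$ and $(\|\overline{G_k}\|)$ is bounded. *)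

(* Defs.v *)
(* R : realType, X : completeNormedModType R
   equipped with an inner product inducing its norm (= a real Hilbert space). *)
From HB Require Import structures.
From mathcomp Require Import all_boot all_order all_algebra.
From mathcomp Require Import all_classical all_reals all_analysis.
Set Implicit Arguments. Unset Strict Implicit. Unset Printing Implicit Defensive.
Import Order.TTheory GRing.Theory Num.Theory.
Import numFieldNormedType.Exports.
Local Open Scope classical_set_scope.
Local Open Scope ring_scope.

Inductive line_search (R : Type) :=
| Armijo_bt of R & R      (* Armijo with backtracking, parameters beta, sigma *)
| Wolfe_Powell of R & R.  (* Wolfe--Powell, parameters sigma, eta *)

Section SLBFGS.
Context {R : realType} {X : normedModType R}.

Definition inner_product (ip : X -> X -> R) : Prop :=
  [/\ forall (a : R) (u v w : X), ip (a *: u + v) w = a * ip u w + ip v w,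
      forall u v, ip u v = ip v u &
      forall u, ip u u = `|u| ^+ 2].

Definition C1_with_gradient (ip : X -> X -> R) (J : X -> R) (gJ : X -> X) : Prop :=
  (forall x, differentiable J x /\ forall v, 'd J x v = ip (gJ x) v)
  /\ continuous gJ.

Definition C2_with_hessian (gJ : X -> X) (H : X -> X -> X) : Prop :=
  (forall x, differentiable gJ x /\ forall v, 'd gJ x v = H x v)
  /\ (forall x (e : R), 0 < e -> exists2 r : R, 0 < r &
        forall z, `|z - x| < r -> forall v, `|H z v - H x v| <= e * `|v|).

Definition linear_op (A : X -> X) : Prop :=
  forall (a : R) u v, A (a *: u + v) = a *: A u + A v.

Definition sym_psd_bounded (ip : X -> X -> R) (A : X -> X) : Prop :=
  [/\ linear_op A, exists M : R, forall v, `|A v| <= M * `|v|,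
      forall u v, ip (A u) v = ip u (A v) &
      forall v, 0 <= ip (A v) v].

(* one L-BFGS update  B |-> B + y y^T/(y^T s) - B s s^T B/(s^T B s) *)
Definition lbfgs_update (ip : X -> X -> R) (B : X -> X) (s y : X) : X -> X :=
  fun v => B v + (ip y v / ip y s) *: y - (ip s (B v) / ip s (B s)) *: B s.

Definition lbfgs_op (ip : X -> X -> R) (cs : R) (B0 : X -> X)
    (s y : nat -> X) (m k : nat) : X -> X :=
  foldl (fun B j => if cs * `|s j| ^+ 2 < ip (y j) (s j)
                    then lbfgs_update ip B (s j) (y j) else B)
        B0 (iota m (k - m)).

Definition proj_interval (wl : R) (wu : \bar R) (t : R) : R :=
  match wu with
  | EFin r => Num.min (Num.max t wl) r
  | _ => Num.max t wl
  end.

Definition armijo (ip : X -> X -> R) (J : X -> R) (gJ : X -> X) (sigma : R)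
    (x d : X) (a : R) : Prop :=
  J (x + a *: d) <= J x + a * sigma * ip (gJ x) d.

Definition line_search_params (ls : line_search R) : Prop :=
  match ls with
  | Armijo_bt beta sigma => 0 < beta < 1 /\ 0 < sigma < 1
  | Wolfe_Powell sigma eta => 0 < sigma /\ sigma < eta < 1
  end.

Definition step_ok (ls : line_search R) (ip : X -> X -> R) (J : X -> R)
    (gJ : X -> X) (x d : X) (a : R) : Prop :=
  match ls with
  | Armijo_bt beta sigma =>
      exists i : nat, a = beta ^+ i /\ armijo ip J gJ sigma x d (beta ^+ i) /\
        forall i' : nat, (i' < i)%N -> ~ armijo ip J gJ sigma x d (beta ^+ i')
  | Wolfe_Powell sigma eta =>
      0 < a /\ armijo ip J gJ sigma x d a /\
      eta * ip (gJ x) d <= ip (gJ (x + a *: d)) d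
  end.

(* iteration k is executed: the algorithm did not stop in iterations 0..k-1 *)
Definition active (gJ : X -> X) (eps : R) (x : nat -> X) (k : nat) : Prop :=
  forall j, (j < k)%N -> eps < `|gJ (x j.+1)|.

Definition Omega (J : X -> R) (x0 : X) : set X := [set x | J x <= J x0].

Definition Omega_delta (J : X -> R) (x0 : X) (delta : R) : set X :=
  [set x | exists2 xh, Omega J x0 xh & `|x - xh| < delta].

Definition unif_cont_on_R (A : set X) (f : X -> R) : Prop :=
  forall e : R, 0 < e -> exists2 r : R, 0 < r &
    forall u v, A u -> A v -> `|u - v| < r -> `|f u - f v| < e.

Definition unif_cont_on_X (A : set X) (f : X -> X) : Prop :=
  forall e : R, 0 < e -> exists2 r : R, 0 < r &
    forall u v, A u -> A v -> `|u - v| < r -> `|f u - f v| < e.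

(* <Gbar_k v, w> where Gbar_k = int_0^1 Hess J(x_k + t s_k) dt - S_{k+1} *)
Definition Gbar_form (ip : X -> X -> R) (H : X -> X -> X) (S1 : X -> X)
    (xk sk v w : X) : R :=
  Rintegral (@lebesgue_measure R) `[0%R, 1%R]
            (fun t : R => ip (H (xk + t *: sk) v) w) - ip (S1 v) w.

(* A run of Algorithm SLBFGS: iterates x, scalings tau, structured operators S,
   directions d and step sizes alpha.  The rules are imposed on every executed
   iteration k (values after termination are irrelevant). *)
Definition slbfgs_run (ip : X -> X -> R) (J : X -> R) (gJ : X -> X)
    (eps : R) (ell : nat) (c0 : R) (C0 : \bar R) (cs c1 c2 : R)
    (tau_g_variant : bool) (ls : line_search R)
    (x : nat -> X) (tau : nat -> R) (S : nat -> X -> X) (d : nat -> X)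
    (alpha : nat -> R) : Prop :=
  0 < tau 0 /\
  forall k, active gJ eps x k ->
    let s := fun j => alpha j *: d j in
    let y := fun j => gJ (x j.+1) - gJ (x j) in
    [/\ sym_psd_bounded ip (S k),
        (* d_k = - B_k^{-1} grad J(x_k) *)
        lbfgs_op ip cs (fun v => tau k *: v + S k v) s y (k - ell)%N k (d k)
          = - gJ (x k),
        step_ok ls ip J gJ (x k) (d k) (alpha k),
        x k.+1 = x k + s k &
        eps < `|gJ (x k.+1)| ->
          let g1 := `|gJ (x k.+1)| in
          let z := y k - S k.+1 (s k) in
          let wl := Num.min c0 (c1 * g1 `^ c2) in
          let wu := maxe C0 ((c1 * g1 `^ c2)^-1)%:E in
          let P := proj_interval wl wu in
          let rho := ip z (s k) in
          let taus := P (rho / `|s k| ^+ 2) in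
          let taug := P (`|z| / `|s k|) in
          let tauz := P (`|z| ^+ 2 / rho) in
          if (0 < rho) && ~~ tau_g_variant then taus <= tau k.+1 <= tauz
          else taus <= tau k.+1 <= taug].

End SLBFGS.

(* Main.v *)
(* The L-BFGS operators B_k are uniformly bounded and uniformly positive along
   the indices k with |grad J(x_k)| >= e: there the scalings tau_k lie in a fixed
   interval, and each of the at most ell updates spoils the spectral bounds only
   by an amount controlled by L and c_s. On such k the direction d_k is therefore
   uniformly gradient-related, and the Lipschitz condition on the level set bounds
   the step length from below, so J drops by a fixed amount. As J is
   nonincreasing along the run and bounded below, this happens only finitely
   often, for every e > 0. *)
Require Import Defs.
From HB Require Import structures.
From mathcomp Require Import all_boot all_order all_algebra.
From mathcomp Require Import all_classical all_reals all_analysis.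
From mathcomp Require Import ring lra.
Import Order.TTheory GRing.Theory Num.Theory.
Import numFieldNormedType.Exports.
Local Open Scope classical_set_scope.
Local Open Scope ring_scope.

Section RealLine.
Context {R : realType}.

Lemma is_derive_lt0_right (f : R -> R) (t c : R) :
  is_derive t 1 f c -> c < 0 ->
  exists2 r : R, 0 < r & forall h, 0 < h < r -> f (t + h) < f t.
Proof.
move=> dfc c0; have df : derivable f t 1 by [].
have fc : 'D_1 f t = c by exact: derive_val.
have : (fun h => h^-1 *: ((f \o shift t) (h *: (1 : R)) - f t)) @ 0^' --> c.
  by rewrite -fc; exact: df.
move=> /cvgr_lt /(_ 0 c0); rewrite near_withinE => /nbhs_ballP[r /= r0 hr].
exists r => // h /andP[h0 hlt].
have := hr h; rewrite /ball /= sub0r normrN gtr0_norm// => /(_ hlt).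
move=> /(_ (lt0r_neq0 h0)); rewrite /shift /= [h *: 1]mulr1 => hq.
have : h^-1 * (f (h + t) - f t) < 0 by exact: hq.
by rewrite pmulr_rlt0 ?invr_gt0// subr_lt0 addrC.
Qed.

(* At the infimum of the points where phi > 0 one has phi <= 0 by continuity,
   and the negative slope there extends phi <= 0 further to the right. *)
Lemma le0_of_negative_slope (phi dphi : R -> R) (a : R) :
  (forall t : R, is_derive t 1 phi (dphi t)) -> phi 0 <= 0 -> 0 <= a ->
  (forall t, 0 <= t <= a -> phi t <= 0 -> dphi t < 0) -> phi a <= 0.
Proof.
move=> dp p0 a0 slope; rewrite leNgt; apply/negP => pa.
pose A := [set t | 0 <= t <= a /\ 0 < phi t].
have Aa : A a by split=> //; rewrite a0 lexx.
have lbA : lbound A 0 by move=> t [/andP[]].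
have infA : has_inf A by split; [exists a|exists 0].
set ts := inf A.
have ts0 : 0 <= ts by apply: lb_le_inf => //; exists a.
have tsa : ts <= a by apply: ge_inf => //; exists 0.
have below t : 0 <= t -> t < ts -> phi t <= 0.
  move=> t0 tts; rewrite leNgt; apply/negP => pt.
  have : ts <= t.
    apply: ge_inf; first by exists 0.
    by split=> //; rewrite t0 (ltW (lt_le_trans tts tsa)).
  by rewrite leNgt tts.
have pts : phi ts <= 0.
  rewrite leNgt; apply/negP => pgt.
  have ts_gt0 : 0 < ts.
    rewrite lt_neqAle ts0 andbT; apply: contraTneq pgt => <-.
    by rewrite -leNgt.
  have cphi : {for ts, continuous phi}.
    apply: differentiable_continuous; apply/derivable1_diffP.
    by have := dp ts; case.
  have : phi @ ts --> phi ts by exact: cphi.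
  move=> /cvgr_gt /(_ 0 pgt) /nbhs_ballP[r /= r0 hr].
  set t := Num.max 0 (ts - r / 2).
  have tts : t < ts by rewrite gt_max ts_gt0 gtrBl divr_gt0.
  have : 0 < phi t.
    apply: hr; rewrite /ball /= ger0_norm ?subr_ge0 ?(ltW tts)//.
    have : ts - r / 2 <= t by rewrite le_max lexx orbT.
    by move=> h; lra.
  by rewrite ltNge below// le_max lexx.
have [r r0 hr] := is_derive_lt0_right _ _ _ (dp ts)
  (slope ts (introT andP (conj ts0 tsa)) pts).
have [t [tA pt] tlt] := inf_adherent r0 infA.
have tst : ts <= t by apply: ge_inf; [exists 0|split].
move: tst; rewrite le_eqVlt => /orP[/eqP tE|tst].
  by move: pt; rewrite -tE ltNge pts.
have := hr (t - ts); rewrite subr_gt0 tst ltrBlDl tlt addrC subrK => /(_ isT).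
by move=> /lt_le_trans /(_ pts) /(lt_trans pt); rewrite ltxx.
Qed.

Lemma is_derive_line {X W : normedModType R} (f : X -> W) (x d : X) (t : R) :
  differentiable f (x + t *: d) ->
  is_derive t 1 (fun t : R => f (x + t *: d)) ('d f (x + t *: d) d).
Proof.
move=> df; set F := (fun t : R => _).
have E : (fun h : R => h^-1 *: ((F \o shift t) (h *: (1 : R)) - F t))
       = (fun h : R => h^-1 *: ((f \o shift (x + t *: d)) (h *: d) - f (x + t *: d))).
  by apply/funext => h; rewrite /F /= [h *: 1]mulr1 scalerDl addrCA.
apply: DeriveDef; first by rewrite /derivable E; exact: diff_derivable.
by rewrite -deriveE// /derive E.
Qed.

Lemma proj_interval_ge (a : R) (b : \bar R) (t : R) :
  (a%:E <= b)%E -> a <= proj_interval a b t.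
Proof.
have am : a <= Num.max t a by rewrite le_max lexx orbT.
by case: b => [r| |] //=; rewrite lee_fin le_min am => ->.
Qed.

Lemma proj_interval_le_max (a : R) (b : \bar R) (t : R) :
  proj_interval a b t <= Num.max t a.
Proof. by case: b => [r| |] //=; rewrite ge_min lexx. Qed.

End RealLine.

Section SemidefiniteForms.
Context {R : realType} {X : lmodType R}.
Variable q : X -> X -> R.
Hypothesis q_lin : forall (a : R) u v w, q (a *: u + v) w = a * q u w + q v w.
Hypothesis q_sym : forall u v, q u v = q v u.
Hypothesis q_ge0 : forall v, 0 <= q v v.

Lemma form_linr (a : R) u v w : q w (a *: u + v) = a * q w u + q w v.
Proof. by rewrite q_sym q_lin !(q_sym w). Qed.

Lemma form0l w : q 0 w = 0.
Proof. by have := q_lin 1 0 0 w; rewrite scaler0 addr0; lra. Qed.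

Lemma formZl (a : R) u w : q (a *: u) w = a * q u w.
Proof. by rewrite -[a *: u]addr0 q_lin form0l addr0. Qed.

Lemma form_lin2 (a b : R) u v :
  q (a *: u + b *: v) (a *: u + b *: v)
  = a ^+ 2 * q u u + 2 * a * b * q u v + b ^+ 2 * q v v.
Proof.
rewrite q_lin formZl !form_linr (q_sym u (b *: v)) (q_sym v (b *: v)) !formZl.
by rewrite (q_sym v u); ring.
Qed.

Lemma form_CauchySchwarz u v : q u v ^+ 2 <= q u u * q v v.
Proof.
have pos w1 w2 : 0 < q w1 w1 -> q w1 w2 ^+ 2 <= q w1 w1 * q w2 w2.
  move=> w1_gt0; have := q_ge0 ((- q w1 w2) *: w1 + q w1 w1 *: w2).
  rewrite form_lin2 => h.
  rewrite -subr_ge0 -(pmulr_rge0 _ w1_gt0); apply: le_trans h _.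
  by rewrite le_eqVlt; apply/orP; left; apply/eqP; ring.
have := q_ge0 u; rewrite le_eqVlt => /orP[/eqP u0|]; last exact: pos.
have := q_ge0 v; rewrite le_eqVlt => /orP[/eqP v0|].
  have := q_ge0 (1 *: u + 1 *: v); have := q_ge0 ((-1) *: u + 1 *: v).
  rewrite !form_lin2 -u0 -v0 => h1 h2.
  have -> : q u v = 0 by lra.
  by rewrite expr0n mulr0.
by move/pos => /(_ u); rewrite q_sym mulrC.
Qed.

End SemidefiniteForms.

Section Hilbert.
Context {R : realType} {X : normedModType R}.
Variable ip : X -> X -> R.
Hypothesis ipP : inner_product ip.

Let ip_lin (a : R) u v w : ip (a *: u + v) w = a * ip u w + ip v w.
Proof. by case: ipP. Qed.

Let ipC u v : ip u v = ip v u.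
Proof. by case: ipP. Qed.

Lemma ip_norm u : ip u u = `|u| ^+ 2.
Proof. by case: ipP. Qed.

Let ip_ge0 u : 0 <= ip u u.
Proof. by rewrite ip_norm exprn_ge0. Qed.

Lemma ip0l w : ip 0 w = 0. Proof. exact: form0l ip_lin w. Qed.

Lemma ipZl (a : R) u w : ip (a *: u) w = a * ip u w.
Proof. exact: formZl ip_lin a u w. Qed.

Lemma ipDl u v w : ip (u + v) w = ip u w + ip v w.
Proof. by rewrite -[u]scale1r ip_lin scale1r mul1r. Qed.

Lemma ipNl u w : ip (- u) w = - ip u w.
Proof. by rewrite -scaleN1r ipZl mulN1r. Qed.

Lemma ipBl u v w : ip (u - v) w = ip u w - ip v w.
Proof. by rewrite ipDl ipNl. Qed.

Lemma ip_le u v : `|ip u v| <= `|u| * `|v|.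
Proof.
rewrite -(@ler_pXn2r _ 2) ?nnegrE ?mulr_ge0// -normrX ger0_norm ?sqr_ge0//.
by rewrite exprMn -!ip_norm; exact: form_CauchySchwarz.
Qed.

Definition sym_bounds (m M : R) (B : X -> X) : Prop :=
  [/\ linear_op B, forall u v, ip (B u) v = ip u (B v) &
      forall v, m * `|v| ^+ 2 <= ip (B v) v <= M * `|v| ^+ 2].

Lemma sym_boundsW {m M : R} (m' M' : R) B :
  m' <= m -> M <= M' -> sym_bounds m M B -> sym_bounds m' M' B.
Proof.
move=> mm MM [Bl Bs Bb]; split=> // v; have /andP[b1 b2] := Bb v.
rewrite (le_trans _ b1) ?(le_trans b2)//; by rewrite ler_wpM2r ?sqr_ge0.
Qed.

Lemma sym_bounds_norm m M B v : 0 <= m -> sym_bounds m M B ->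
  `|B v| ^+ 2 <= M * ip (B v) v.
Proof.
move=> m0 [Bl Bs Bb].
have Bf_lin (a : R) u w z : ip (B (a *: u + w)) z = a * ip (B u) z + ip (B w) z.
  by rewrite Bl ip_lin.
have Bf_sym u w : ip (B u) w = ip (B w) u by rewrite Bs ipC.
have Bf_ge0 u : 0 <= ip (B u) u.
  by have /andP[h _] := Bb u; rewrite (le_trans _ h)// mulr_ge0 ?sqr_ge0.
have := form_CauchySchwarz _ Bf_lin Bf_sym Bf_ge0 v (B v).
have [->|Bv0] := eqVneq (B v) 0.
  by move=> _; rewrite normr0 ip0l mulr0 expr0n.
rewrite ip_norm => h.
have Bv_gt0 : 0 < `|B v| ^+ 2 by rewrite exprn_gt0 ?normr_gt0.
have /andP[_ h2] := Bb (B v).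
have : ip (B v) v * ip (B (B v)) (B v) <= ip (B v) v * (M * `|B v| ^+ 2).
  by rewrite ler_wpM2l.
move=> /(le_trans h); rewrite expr2 mulrA ler_pM2r//.
by rewrite mulrC.
Qed.

Lemma sym_psd_inverse_bound (M N : R) B :
  sym_bounds 0 N B -> 0 < N -> 0 < M -> (forall v, `|v| <= M * `|B v|) ->
  sym_bounds (M ^+ 2 * N)^-1 N B.
Proof.
move=> sB N0 M0 hM; have nB := sym_bounds_norm _ _ _ _ (lexx 0) sB.
case: sB => Bl Bs Bb; split=> // v; have /andP[_ ->] := Bb v; rewrite andbT.
rewrite mulrC ler_pdivrMr ?mulr_gt0 ?exprn_gt0//.
have h : `|v| ^+ 2 <= M ^+ 2 * `|B v| ^+ 2.
  by rewrite -exprMn ler_pXn2r ?nnegrE ?mulr_ge0 // ltW.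
apply: le_trans h _.
rewrite [X in _ <= X](_ : _ = M ^+ 2 * (N * ip (B v) v)); last by ring.
by rewrite ler_wpM2l ?sqr_ge0.
Qed.

Section Update.
Variables (cs L : R).
Hypotheses (cs_gt0 : 0 < cs) (L_gt0 : 0 < L).

Lemma lbfgs_update_form (B : X -> X) s y v :
  (forall u w, ip (B u) w = ip u (B w)) ->
  ip (lbfgs_update ip B s y v) v
  = ip (B v) v + ip y v ^+ 2 / ip y s - ip (B s) v ^+ 2 / ip (B s) s.
Proof.
move=> Bs; rewrite /lbfgs_update ipBl ipDl !ipZl -!(Bs s); ring.
Qed.

(* With t = <Bs,v>/<Bs,s> and w = v - t s, the B-orthogonality of w and s turns
   the updated form into <Bw,w> + <y,v>^2/<y,s>, and v is recovered from w and
   <y,v> through t <y,s> = <y,v> - <y,w>. *)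
Lemma lbfgs_update_lower (m M : R) B s y v : 0 < m -> sym_bounds m M B ->
  `|y| <= L * `|s| -> cs * `|s| ^+ 2 < ip y s ->
  `|v| ^+ 2 <= (2 * (1 + L / cs) ^+ 2 / m + 2 / cs)
               * ip (lbfgs_update ip B s y v) v.
Proof.
move=> m0 [Bl Bs Bb] yLs ys; rewrite lbfgs_update_form//.
have ys0 : 0 < ip y s by rewrite (le_lt_trans _ ys)// mulr_ge0 ?sqr_ge0// ltW.
have s0 : 0 < `|s|.
  rewrite normr_gt0; apply: contraTneq ys0 => ->.
  by rewrite ipC ip0l ltxx.
have Bss0 : 0 < ip (B s) s.
  by have /andP[h _] := Bb s; rewrite (lt_le_trans _ h)// mulr_gt0 ?exprn_gt0.
set t := ip (B s) v / ip (B s) s; set w := (- t) *: s + v.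
have vE : v = w + t *: s by rewrite /w scaleNr addrAC addNr add0r.
have Bww : ip (B w) w = ip (B v) v - ip (B s) v ^+ 2 / ip (B s) s.
  have Bf_lin (a : R) u1 u2 z : ip (B (a *: u1 + u2)) z = a * ip (B u1) z + ip (B u2) z.
    by rewrite Bl ip_lin.
  have Bf_sym u1 u2 : ip (B u1) u2 = ip (B u2) u1 by rewrite Bs ipC.
  have := form_lin2 _ Bf_lin Bf_sym (- t) 1 s v; rewrite scale1r -/w => ->.
  rewrite /t; field; exact: lt0r_neq0.
rewrite -addrAC -Bww.
set Y := ip y v ^+ 2 / ip y s.
have Y0 : 0 <= Y by rewrite divr_ge0 ?sqr_ge0 ?ltW.
have /andP[Bw _] := Bb w.
have a0 : 0 <= L / cs by rewrite divr_ge0 ?ltW.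
set a := L / cs in a0 *.
have s2 : `|s| ^+ 2 / ip y s <= cs^-1.
  by rewrite ler_pdivrMr// mulrC ler_pdivlMr// mulrC ltW.
have nv : `|v| <= (1 + a) * `|w| + `|s| * `|ip y v| / ip y s.
  have -> : `|s| * `|ip y v| / ip y s = `|(ip y v / ip y s) *: s|.
    by rewrite normrZ normrM normfV (gtr0_norm ys0); ring.
  have E : v = (w - (ip y w / ip y s) *: s) + (ip y v / ip y s) *: s.
    rewrite -[RHS]addrA -scaleNr -scalerDl {1}vE; congr (_ + _ *: _).
    rewrite [in ip y v]vE (ipC y (w + _)) ipDl ipZl (ipC w) (ipC s).
    by field; exact: lt0r_neq0.
  rewrite {1}E (le_trans (ler_normD _ _))// lerD2r (le_trans (ler_normB _ _))//.
  rewrite mulrDl mul1r lerD2l normrZ normrM normfV (gtr0_norm ys0).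
  have h : `|ip y w| <= L * `|s| * `|w|.
    by rewrite (le_trans (ip_le _ _))// ler_wpM2r.
  have h2 : `|ip y w| / ip y s * `|s| <= L * `|s| * `|w| / ip y s * `|s|.
    by rewrite ler_wpM2r// ler_wpM2r// invr_ge0 ltW.
  apply: le_trans h2 _.
  have -> : L * `|s| * `|w| / ip y s * `|s| = (L * `|w|) * (`|s| ^+ 2 / ip y s) by ring.
  rewrite /a [X in _ <= X](_ : _ = (L * `|w|) * cs^-1); last by ring.
  by rewrite ler_wpM2l// mulr_ge0// ltW.
have p2 : (`|s| * `|ip y v| / ip y s) ^+ 2 <= Y / cs.
  rewrite !exprMn real_normK ?num_real//.
  have -> : `|s| ^+ 2 * ip y v ^+ 2 * (ip y s)^-1 ^+ 2 = Y * (`|s| ^+ 2 / ip y s).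
    by rewrite /Y; ring.
  by rewrite ler_wpM2l.
set p := `|s| * `|ip y v| / ip y s in nv p2.
have p0 : 0 <= p by rewrite /p divr_ge0 ?mulr_ge0 // ltW.
set W := (1 + a) * `|w| in nv.
have W0 : 0 <= W by rewrite mulr_ge0// addr_ge0.
have v2 : `|v| ^+ 2 <= 2 * W ^+ 2 + 2 * p ^+ 2.
  have h : `|v| ^+ 2 <= (W + p) ^+ 2 by rewrite ler_pXn2r ?nnegrE ?addr_ge0.
  by apply: le_trans h _; have := sqr_ge0 (W - p); nra.
have w2 : W ^+ 2 <= (1 + a) ^+ 2 / m * ip (B w) w.
  rewrite /W exprMn -mulrA ler_wpM2l ?sqr_ge0//.
  by rewrite mulrC ler_pdivlMr// mulrC.
have Bw0 : 0 <= ip (B w) w by rewrite (le_trans _ Bw)// mulr_ge0 ?sqr_ge0// ltW.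
have c1 : 0 <= (1 + a) ^+ 2 / m * Y by rewrite mulr_ge0// divr_ge0 ?sqr_ge0// ltW.
have c2 : 0 <= cs^-1 * ip (B w) w by rewrite mulr_ge0// invr_ge0 ltW.
have -> : (2 * (1 + a) ^+ 2 / m + 2 / cs) * (ip (B w) w + Y) =
  2 * ((1 + a) ^+ 2 / m * ip (B w) w) + 2 * (Y / cs)
  + 2 * ((1 + a) ^+ 2 / m * Y) + 2 * (cs^-1 * ip (B w) w) by ring.
lra.
Qed.

Lemma lbfgs_update_bounds (m M : R) B s y : 0 < m -> sym_bounds m M B ->
  `|y| <= L * `|s| -> cs * `|s| ^+ 2 < ip y s ->
  sym_bounds (2 * (1 + L / cs) ^+ 2 / m + 2 / cs)^-1 (M + L ^+ 2 / cs)
    (lbfgs_update ip B s y).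
Proof.
move=> m0 sB yLs ys; have [Bl Bs Bb] := sB; split.
- move=> a u v; rewrite /lbfgs_update Bl !(ipC y (a *: u + v)).
  rewrite (ipC s (a *: B u + B v)) !ip_lin !mulrDl !scalerDl !(ipC _ y) !(ipC _ s).
  rewrite -!mulrA -!(scalerA a) !scalerBr !scalerDr.
  by rewrite opprD [RHS]addrACA; congr (_ + _); rewrite addrACA.
- move=> u v; rewrite /lbfgs_update ipBl ipDl !ipZl (ipC u) ipBl ipDl !ipZl.
  by rewrite -!(Bs s) (Bs u v) (ipC u (B v)); ring.
- move=> v; apply/andP; split.
    have K0 : 0 < 2 * (1 + L / cs) ^+ 2 / m + 2 / cs.
      have L0 : 0 < L / cs by rewrite divr_gt0.
      by rewrite addr_gt0 ?divr_gt0 ?mulr_gt0 ?exprn_gt0 ?addr_gt0.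
    by rewrite mulrC ler_pdivrMr// mulrC; exact: lbfgs_update_lower sB yLs ys.
  have ys0 : 0 < ip y s by rewrite (le_lt_trans _ ys)// mulr_ge0 ?sqr_ge0// ltW.
  have s0 : 0 < `|s|.
    rewrite normr_gt0; apply: contraTneq ys0 => ->.
    by rewrite ipC ip0l ltxx.
  rewrite lbfgs_update_form// mulrDl.
  have /andP[_ h1] := Bb v.
  have /andP[h2 _] := Bb s.
  have h3 : 0 <= ip (B s) v ^+ 2 / ip (B s) s.
    by rewrite divr_ge0 ?sqr_ge0// (le_trans _ h2)// mulr_ge0 ?sqr_ge0// ltW.
  have h4 : ip y v ^+ 2 / ip y s <= L ^+ 2 / cs * `|v| ^+ 2.
    rewrite ler_pdivrMr//.
    have h : ip y v ^+ 2 <= (L * `|s| * `|v|) ^+ 2.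
      rewrite -(real_normK (num_real (ip y v))) ler_pXn2r ?nnegrE ?mulr_ge0 ?(ltW L_gt0)//.
      by rewrite (le_trans (ip_le _ _))// ler_wpM2r.
    apply: le_trans h _.
    have -> : (L * `|s| * `|v|) ^+ 2 = (L ^+ 2 / cs * `|v| ^+ 2) * (cs * `|s| ^+ 2).
      by field; exact: lt0r_neq0.
    by rewrite ler_wpM2l ?(ltW ys)// mulr_ge0 ?sqr_ge0// divr_ge0 ?sqr_ge0 ?ltW.
  lra.
Qed.

Lemma lbfgs_fold_bounds (n : nat) (m M : R) : 0 < m ->
  exists m' M' : R, 0 < m' /\
  forall (s y : nat -> X) (l : seq nat) (B : X -> X), (size l <= n)%N ->
    (forall j, j \in l -> `|y j| <= L * `|s j|) -> sym_bounds m M B ->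
    sym_bounds m' M' (foldl (fun B j => if cs * `|s j| ^+ 2 < ip (y j) (s j)
                    then lbfgs_update ip B (s j) (y j) else B) B l).
Proof.
elim: n m M => [|n IH] m M m0.
  by exists m, M; split=> // s y [|//] B _ _.
set m1 := (2 * (1 + L / cs) ^+ 2 / m + 2 / cs)^-1.
have m10 : 0 < m1.
  have L0 : 0 < L / cs by rewrite divr_gt0.
  by rewrite invr_gt0 addr_gt0 ?divr_gt0 ?mulr_gt0 ?exprn_gt0 ?addr_gt0.
have [|m' [M' [m'0 h]]] := IH (Num.min m m1) (M + L ^+ 2 / cs).
  by rewrite lt_min m0.
have MM : M <= M + L ^+ 2 / cs by rewrite lerDl divr_ge0 ?sqr_ge0 ?ltW.
exists m', M'; split=> // s y [|j l] B /= ln ly sB.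
  apply: (h s y [::]) => //; apply: sym_boundsW sB => //.
  by rewrite ge_min lexx.
apply: h => //.
  by move=> i il; apply: ly; rewrite inE il orbT.
case: ifPn => [ys|_].
  have := lbfgs_update_bounds _ _ _ _ _ m0 sB (ly j (mem_head _ _)) ys.
  by apply: sym_boundsW => //; rewrite ge_min lexx orbT.
by apply: sym_boundsW sB => //; rewrite ge_min lexx.
Qed.

End Update.

Section LineSearch.
Variables (J : X -> R) (gJ : X -> X) (x0 : X) (L : R).
Hypothesis J_C1 : C1_with_gradient ip J gJ.
Hypothesis L_gt0 : 0 < L.
Hypothesis gJ_Lip : forall u v, Omega J x0 u -> Omega J x0 v ->
  `|gJ u - gJ v| <= L * `|u - v|.

(* As long as the Armijo inequality holds, the trial point stays in the level
   set, where the gradient is Lipschitz. *)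
Lemma armijo_small_step (sigma : R) x d (a : R) :
  0 < sigma < 1 -> Omega J x0 x -> 0 <= a ->
  L * a * `|d| ^+ 2 < (1 - sigma) * - ip (gJ x) d ->
  armijo ip J gJ sigma x d a.
Proof.
move=> /andP[s0 s1] xO a0 small.
have [J_diff _] := J_C1.
set g := ip (gJ x) d in small *.
have d2 : 0 <= `|d| ^+ 2 by rewrite sqr_ge0.
have g0 : g < 0.
  have : 0 <= L * a * `|d| ^+ 2 by rewrite !mulr_ge0// ltW.
  by move=> /le_lt_trans /(_ small); rewrite pmulr_rgt0 ?subr_gt0// oppr_gt0.
pose phi (t : R) := J (x + t *: d) - (J x + t * (sigma * g)).
suff : phi a <= 0 by rewrite /phi subr_le0 mulrA.
apply: (@le0_of_negative_slope _ phi
         (fun t => ip (gJ (x + t *: d)) d - sigma * g)) => //.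
- move=> t; have [Jd Jg] := J_diff (x + t *: d).
  have h1 : is_derive t 1 (fun t : R => J (x + t *: d)) (ip (gJ (x + t *: d)) d).
    by rewrite -Jg; exact: is_derive_line.
  have h2 : is_derive t 1 (fun t : R => J x + t * (sigma * g)) (sigma * g).
    by apply: is_derive_eq; rewrite scaler0 !add0r mul1r [_ *: _]mulr1.
  exact: (is_deriveB h1 h2).
- by rewrite /phi scale0r addr0 mul0r addr0 subrr.
- move=> t /andP[t0 ta] pt.
  have tO : Omega J x0 (x + t *: d).
    rewrite /Omega /=; move: pt; rewrite /phi subr_le0 => /le_trans; apply.
    apply: le_trans _ xO; rewrite gerDl mulr_ge0_le0//.
    by rewrite mulr_ge0_le0// ltW.
  have h : ip (gJ (x + t *: d)) d - g <= L * t * `|d| ^+ 2.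
    rewrite /g -ipBl (le_trans (ler_norm _))// (le_trans (ip_le _ _))//.
    rewrite expr2 mulrA ler_wpM2r// (le_trans (gJ_Lip _ _ tO xO))//.
    by rewrite addrAC subrr add0r normrZ ger0_norm// mulrA.
  have h2 : L * t * `|d| ^+ 2 <= L * a * `|d| ^+ 2.
    by rewrite ler_wpM2r// ler_wpM2l// ltW.
  lra.
Qed.

Lemma step_nonincreasing ls x d (a : R) : line_search_params ls ->
  ip (gJ x) d <= 0 -> step_ok ls ip J gJ x d a -> J (x + a *: d) <= J x.
Proof.
move=> lsP gd; have aux (sg b : R) : 0 <= sg -> 0 <= b ->
    armijo ip J gJ sg x d b -> J (x + b *: d) <= J x.
  move=> sg0 b0; rewrite /armijo => /le_trans; apply.
  by rewrite gerDl mulr_ge0_le0// mulr_ge0.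
case: ls lsP => /= [beta sigma [/andP[b0 _] /andP[s0 _]] [i [-> [h _]]]|
                    sigma eta [s0 _] [a0 [h _]]].
  by apply: aux h; rewrite ?exprn_ge0 ?ltW.
by apply: aux h; rewrite ltW.
Qed.

Lemma step_sufficient_decrease ls (m : R) : line_search_params ls -> 0 < m ->
  exists2 c : R, 0 < c & forall x d (a : R), Omega J x0 x ->
    0 < - ip (gJ x) d -> m * `|d| ^+ 2 <= - ip (gJ x) d ->
    step_ok ls ip J gJ x d a -> J (x + a *: d) <= J x - c * - ip (gJ x) d.
Proof.
move=> lsP m0; case: ls lsP => /= [beta sigma|sigma eta].
- move=> [/andP[b0 b1] /andP[s0 s1]].
  have k0 : 0 < beta * (1 - sigma) * m / L by rewrite divr_gt0 ?mulr_gt0 ?subr_gt0.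
  exists (sigma * Num.min 1 (beta * (1 - sigma) * m / L)).
    by rewrite mulr_gt0// lt_min ltr01 k0.
  move=> x d a xO p0 mp [i [-> [arm fails]]].
  apply: le_trans arm _; set p := - ip (gJ x) d in p0 mp *.
  have -> : ip (gJ x) d = - p by rewrite opprK.
  rewrite mulrN lerD2l lerN2 ler_wpM2r ?(ltW p0)// [X in _ <= X]mulrC ler_wpM2l ?(ltW s0)//.
  rewrite ge_min; case: i fails => [|i] fails; first by rewrite expr0 lexx.
  apply/orP; right; rewrite exprS -!mulrA ler_wpM2l ?(ltW b0)// mulrA.
  rewrite ler_pdivrMr// leNgt; apply/negP => lt; apply: (fails i) => //.
  apply: armijo_small_step => //; rewrite ?s0// ?exprn_ge0 ?(ltW b0)// -/p.
  have [->|d0] := eqVneq d 0.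
    by rewrite normr0 expr0n mulr0 mulr_gt0// subr_gt0.
  have d2 : 0 < `|d| ^+ 2 by rewrite exprn_gt0// normr_gt0.
  apply: (@lt_le_trans _ _ ((1 - sigma) * m * `|d| ^+ 2)).
    by rewrite ltr_pM2r// [L * _]mulrC.
  by rewrite -mulrA ler_wpM2l// subr_ge0 ltW.
- move=> [s0 /andP[se e1]].
  exists (sigma * ((1 - eta) * m / L)).
    by rewrite mulr_gt0// divr_gt0 ?mulr_gt0// subr_gt0.
  move=> x d a xO p0 mp [a0 [arm curv]].
  have gd : ip (gJ x) d <= 0 by rewrite -oppr_ge0 ltW.
  have xO' : Omega J x0 (x + a *: d).
    apply: le_trans arm _; apply: le_trans _ xO.
    by rewrite gerDl mulr_ge0_le0// mulr_ge0// ltW.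
  apply: le_trans arm _; set p := - ip (gJ x) d in p0 mp *.
  have gE : ip (gJ x) d = - p by rewrite opprK.
  rewrite gE mulrN lerD2l lerN2 ler_wpM2r ?(ltW p0)// [X in _ <= X]mulrC ler_wpM2l ?(ltW s0)//.
  rewrite ler_pdivrMr//.
  have h : ip (gJ (x + a *: d)) d - ip (gJ x) d <= L * a * `|d| ^+ 2.
    rewrite -ipBl (le_trans (ler_norm _))// (le_trans (ip_le _ _))//.
    rewrite expr2 mulrA ler_wpM2r// (le_trans (gJ_Lip _ _ xO' xO))//.
    by rewrite addrAC subrr add0r normrZ ger0_norm ?(ltW a0)// mulrA.
  rewrite gE in curv h.
  have k : (1 - eta) * p <= L * a * `|d| ^+ 2 by lra.
  have : m * ((1 - eta) * p) <= (L * a) * p.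
    apply: (@le_trans _ _ (L * a * (m * `|d| ^+ 2))).
      rewrite [X in _ <= X](_ : _ = m * (L * a * `|d| ^+ 2)); last by ring.
      by rewrite ler_wpM2l// ltW.
    by rewrite ler_wpM2l// mulr_ge0// ltW.
  by rewrite mulrA ler_pM2r// mulrC [L * a]mulrC.
Qed.

End LineSearch.

Lemma continuous_ipl (w : X) : continuous (fun u => ip u w).
Proof.
move=> u; apply/cvgrPdist_lt => e e0; apply/nbhs_ballP.
exists (e / (`|w| + 1)); first by rewrite /= divr_gt0// ltr_wpDl.
move=> v; rewrite -ball_normE /= => uv; rewrite -ipBl.
apply: le_lt_trans (ip_le _ _) _.
apply: (@le_lt_trans _ _ (`|u - v| * (`|w| + 1))).
  by rewrite ler_wpM2l// lerDl.
by rewrite -ltr_pdivlMr// ltr_wpDl.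
Qed.

Lemma is_derive_ipl (G : R -> X) (l w : X) (t : R) :
  is_derive t 1 G l -> is_derive t 1 (fun t => ip (G t) w) (ip l w).
Proof.
move=> dG; have dG1 : derivable G t 1 by [].
have Gl : 'D_1 G t = l by exact: derive_val.
set F := (fun t : R => ip (G t) w).
have E : (fun h : R => h^-1 *: ((F \o shift t) (h *: (1 : R)) - F t))
       = (fun u => ip u w) \o
         (fun h : R => h^-1 *: ((G \o shift t) (h *: (1 : R)) - G t)).
  by apply/funext => h; rewrite /F /= ipZl ipBl.
have c : (fun h : R => h^-1 *: ((F \o shift t) (h *: (1 : R)) - F t)) @ 0^' --> ip l w.
  rewrite E; apply: cvg_comp; last exact: (continuous_ipl w l).
  by rewrite -Gl; exact: dG1.
by apply: DeriveDef; [exact: cvgP c|exact: cvg_lim c].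
Qed.

Section MeanHessian.
Variables (gJ : X -> X) (H : X -> X -> X).
Hypothesis H_C2 : C2_with_hessian gJ H.

Lemma hessian_linear z (a : R) u v : H z (a *: u + v) = a *: H z u + H z v.
Proof. by have [Hd _] := H_C2; have [_ h] := Hd z; rewrite -!h linearP. Qed.

Lemma continuous_hessian_line (x s v w : X) :
  continuous (fun t : R => ip (H (x + t *: s) v) w).
Proof.
have [_ Hc] := H_C2.
have cK : continuous (fun z => ip (H z v) w).
  move=> z; apply: (@continuous_comp _ _ _ (fun z => H z v) (fun u => ip u w)); last exact: continuous_ipl.
  apply/cvgrPdist_lt => e e0.
  have e'0 : 0 < e / (`|v| + 1) by rewrite divr_gt0// ltr_wpDl.
  have [r r0 hr] := Hc z _ e'0.
  apply/nbhs_ballP; exists r => // z'; rewrite -ball_normE /= distrC => zz.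
  rewrite distrC; apply: le_lt_trans (hr _ zz v) _.
  rewrite -mulrA gtr_pMr// mulrC ltr_pdivrMr ?ltr_wpDl// mul1r.
  by rewrite ltrDl.
have cl : continuous (fun t : R => x + t *: s).
  by move=> t; apply: cvgD; [exact: cvg_cst|exact: scalel_continuous].
move=> t; apply: (@continuous_comp _ _ _ (fun t : R => x + t *: s) (fun z => ip (H z v) w)).
  exact: cl.
exact: cK.
Qed.

Lemma integrable_hessian_line (x s v w : X) :
  (@lebesgue_measure R).-integrable `[0, 1]
    (EFin \o (fun t : R => ip (H (x + t *: s) v) w)).
Proof.
apply: continuous_compact_integrable; first exact: segment_compact.
by apply: continuous_subspaceT; exact: continuous_hessian_line.
Qed.

Lemma Gbar_form_linear S1 (x s : X) (a : R) u v w : linear_op S1 ->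
  Gbar_form ip H S1 x s (a *: u + v) w
  = a * Gbar_form ip H S1 x s u w + Gbar_form ip H S1 x s v w.
Proof.
move=> Sl; rewrite /Gbar_form Sl ip_lin.
have -> : (fun t : R => ip (H (x + t *: s) (a *: u + v)) w)
  = (fun t => a * ip (H (x + t *: s) u) w + ip (H (x + t *: s) v) w).
  by apply/funext => t; rewrite hessian_linear ip_lin.
have i1 := integrable_hessian_line x s u w.
have i2 := integrable_hessian_line x s v w.
rewrite RintegralD//; last first.
  apply: continuous_compact_integrable; first exact: segment_compact.
  apply: continuous_subspaceT => t; apply: cvgM; first exact: cvg_cst.
  exact: continuous_hessian_line.
rewrite RintegralZl//; ring.
Qed.

Lemma Gbar_form_secant S1 (x s w : X) :
  Gbar_form ip H S1 x s s w = ip (gJ (x + s) - gJ x - S1 s) w.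
Proof.
have [Hd _] := H_C2.
pose F (t : R) := ip (gJ (x + t *: s)) w.
have dF (t : R) : is_derive t 1 F (ip (H (x + t *: s) s) w).
  apply: is_derive_ipl; have [d1 d2] := Hd (x + t *: s).
  by rewrite -d2; exact: is_derive_line.
have dF1 (t : R) : derivable F t 1 by have := dF t; case.
have cF : continuous F.
  by move=> t; apply: differentiable_continuous; apply/derivable1_diffP.
rewrite /Gbar_form /Rintegral (@continuous_FTC2 _ _ F)//.
- by rewrite /= /F scale1r scale0r addr0 !ipBl.
- by apply: continuous_subspaceT; exact: continuous_hessian_line.
- split=> [t _||]; first exact: dF1.
    by apply: cvg_at_right_filter; exact: cF.
  by apply: cvg_at_left_filter; exact: cF.
- by move=> t _; rewrite derive1E; have := dF t; case.
Qed.

Lemma Gbar_quotient_le S1 (x s : X) (M : R) : linear_op S1 ->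
  (forall v w, Gbar_form ip H S1 x s v w = Gbar_form ip H S1 x s w v) ->
  (forall v, 0 <= Gbar_form ip H S1 x s v v) ->
  (forall v w, `|Gbar_form ip H S1 x s v w| <= M * `|v| * `|w|) ->
  let z := gJ (x + s) - gJ x - S1 s in
  0 < ip z s -> `|z| ^+ 2 / ip z s <= M.
Proof.
move=> Sl Gsym G0 GM z zs.
have Glin (a : R) u v w := Gbar_form_linear S1 x s a u v w Sl.
have := form_CauchySchwarz _ Glin Gsym G0 s z.
rewrite !Gbar_form_secant -/z ip_norm => h.
have z0 : 0 < `|z|.
  by rewrite normr_gt0; apply: contraTneq zs => ->; rewrite ip0l ltxx.
have h2 := le_trans (ler_norm _) (GM z z).
rewrite ler_pdivrMr// -(ler_pM2r (exprn_gt0 2 z0)) -expr2.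
apply: le_trans h _; rewrite [M * _]mulrC -mulrA ler_wpM2l ?(ltW zs)//.
by rewrite expr2 mulrA.
Qed.

End MeanHessian.

Section Run.
Variables (J : X -> R) (gJ : X -> X).
Variables (eps : R) (ell : nat) (c0 : R) (C0 : \bar R) (cs c1 c2 : R).
Variables (tau_g_variant : bool) (ls : line_search R) (L : R).
Variables (x : nat -> X) (tau : nat -> R) (S : nat -> X -> X) (d : nat -> X).
Variable alpha : nat -> R.
Hypotheses (eps_ge0 : 0 <= eps) (c0_ge0 : 0 <= c0) (c0_le : (c0%:E <= C0)%E).
Hypotheses (cs_gt0 : 0 < cs) (c1_gt0 : 0 < c1) (c2_gt0 : 0 < c2).
Hypothesis J_C1 : C1_with_gradient ip J gJ.
Hypothesis J_bounded : exists m : R, forall u, m <= J u.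
Hypothesis L_gt0 : 0 < L.
Hypothesis gJ_Lip : forall u v, Omega J (x 0) u -> Omega J (x 0) v ->
  `|gJ u - gJ v| <= L * `|u - v|.
Hypothesis S_bounded :
  exists M : R, forall k, active gJ eps x k -> forall v, `|S k v| <= M * `|v|.
Hypothesis lsP : line_search_params ls.
Hypothesis c0_eq0 : c0 = 0 -> exists M : R, forall k, active gJ eps x k ->
  forall v, `|v| <= M * `|tau k *: v + S k v|.
Hypothesis C0_oo : C0 = +oo%E ->
  tau_g_variant \/
  exists H : X -> X -> X,
    C2_with_hessian gJ H /\
    (forall k, active gJ eps x k.+1 ->
       let sk := alpha k *: d k in
       (forall v w, Gbar_form ip H (S k.+1) (x k) sk v w
                    = Gbar_form ip H (S k.+1) (x k) sk w v) /\
       (forall v, 0 <= Gbar_form ip H (S k.+1) (x k) sk v v)) /\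
    (exists M : R, forall k, active gJ eps x k.+1 ->
       forall v w, `|Gbar_form ip H (S k.+1) (x k) (alpha k *: d k) v w|
                   <= M * `|v| * `|w|).
Hypothesis run :
  slbfgs_run ip J gJ eps ell c0 C0 cs c1 c2 tau_g_variant ls x tau S d alpha.
Hypothesis nonstop : forall k, eps < `|gJ (x k.+1)|.

Let s j := alpha j *: d j.
Let y j := gJ (x j.+1) - gJ (x j).
Let z j := y j - S j.+1 (s j).
Let wl k := Num.min c0 (c1 * `|gJ (x k.+1)| `^ c2).
Let wu k := maxe C0 ((c1 * `|gJ (x k.+1)| `^ c2)^-1)%:E.
Let B0 k v := tau k *: v + S k v.

Let act k : active gJ eps x k.
Proof. by move=> j _; exact: nonstop. Qed.

Let S_psd k : sym_psd_bounded ip (S k).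
Proof. by have [_ /(_ k (act k))[]] := run. Qed.

Let x_next k : x k.+1 = x k + s k.
Proof. by have [_ /(_ k (act k))[]] := run. Qed.

Lemma tau_lower k : wl k <= tau k.+1.
Proof.
have le_wlu : ((wl k)%:E <= wu k)%E.
  by rewrite le_max (le_trans _ c0_le)// lee_fin ge_min lexx.
have [_ /(_ k (act k))[_ _ _ _ /(_ (nonstop k))]] := run; cbv zeta.
by case: ifP => _ /andP[h _]; apply: le_trans h; exact: proj_interval_ge.
Qed.

Lemma tau_upper_proj k : exists2 t, tau k.+1 <= proj_interval (wl k) (wu k) t &
  t = `|z k| / `|s k| \/
  [/\ ~~ tau_g_variant, 0 < ip (z k) (s k) & t = `|z k| ^+ 2 / ip (z k) (s k)].
Proof.
have [_ /(_ k (act k))[_ _ _ _ /(_ (nonstop k))]] := run; cbv zeta.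
case: ifP => [/andP[rho0 vg]|_] /andP[_ h].
  by exists (`|z k| ^+ 2 / ip (z k) (s k)) => //; right.
by exists (`|z k| / `|s k|) => //; left.
Qed.

Let S_norm : exists2 M : R, 0 < M & forall k v, `|S k v| <= M * `|v|.
Proof.
have [M hM] := S_bounded; exists (Num.max M 1).
  by rewrite lt_max ltr01 orbT.
move=> k v; apply: le_trans (hM k (act k) v) _.
by rewrite ler_wpM2r// le_max lexx.
Qed.

Let le_powR (e g : R) : 0 < e -> e <= g -> c1 * e `^ c2 <= c1 * g `^ c2.
Proof.
move=> e0 eg; rewrite ler_wpM2l ?(ltW c1_gt0)//.
by apply: ge0_ler_powR; rewrite ?nnegrE ?(ltW c2_gt0)// ?(ltW e0)// (le_trans (ltW e0)).
Qed.

Lemma tau_upper (e : R) : 0 < e -> exists T : R, forall k,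
  e <= `|gJ (x k.+1)| -> `|y k| <= L * `|s k| -> tau k.+1 <= T.
Proof.
move=> e0; have ce0 : 0 < c1 * e `^ c2 by rewrite mulr_gt0// powR_gt0.
case C0E : C0 => [r| |].
- exists (Num.max r (c1 * e `^ c2)^-1) => k eg _.
  have [t tt _] := tau_upper_proj k; apply: le_trans tt _.
  rewrite /wu C0E -EFin_max /= ge_min; apply/orP; right.
  have := le_powR _ _ e0 eg => h.
  have hi : (c1 * `|gJ (x k.+1)| `^ c2)^-1 <= (c1 * e `^ c2)^-1.
    by rewrite lef_pV2// posrE// (lt_le_trans ce0).
  by rewrite ge_max !le_max lexx /= hi orbT.
- have [MS MS0 hS] := S_norm.
  have [MG hG] : exists MG : R, forall k, ~~ tau_g_variant ->
      0 < ip (z k) (s k) -> `|z k| ^+ 2 / ip (z k) (s k) <= MG.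
    case: (C0_oo C0E) => [vg|[H [HC2 [Hpsd [MG hG]]]]].
      by exists 0 => k; rewrite vg.
    exists MG => k _; rewrite /z /y x_next => rho0.
    have [Gsym Gpsd] := Hpsd k (act k.+1).
    have [Sl _ _ _] := S_psd k.+1.
    exact: (@Gbar_quotient_le _ _ HC2 _ _ _ _ Sl Gsym Gpsd (hG k (act k.+1))).
  exists (Num.max c0 (Num.max (L + MS) MG)) => k _ yL.
  have [t tt tE] := tau_upper_proj k; apply: le_trans tt _.
  apply: le_trans (proj_interval_le_max _ _ _) _.
  rewrite ge_max; apply/andP; split; last first.
    by rewrite /wl ge_min le_max lexx.
  rewrite !le_max; case: tE => [->|[vg rho0 ->]]; last by rewrite hG// !orbT.
  apply/orP; right; apply/orP; left.
  have zL : `|z k| <= (L + MS) * `|s k|.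
    by rewrite mulrDl (le_trans (ler_normB _ _))// lerD.
  have [->|s0] := eqVneq `|s k| 0; first by rewrite invr0 mulr0 addr_ge0 ?ltW.
  by rewrite ler_pdivrMr// lt_neqAle eq_sym s0 normr_ge0.
- by move: c0_le; rewrite C0E.
Qed.

Lemma shifted_bounds k (a b M : R) :
  0 <= a -> a <= tau k -> tau k <= b -> (forall v, `|S k v| <= M * `|v|) ->
  sym_bounds a (b + M) (B0 k).
Proof.
move=> a0 ak kb hM; have [Sl _ Ss Sp] := S_psd k; split.
- move=> c u v; rewrite /B0 Sl !scalerDr !scalerA addrACA.
  by rewrite [tau k * c]mulrC.
- move=> u v; rewrite /B0 ipDl ipZl (ipC u (_ + _)) ipDl ipZl.
  by rewrite (ipC v u) Ss (ipC u (S k v)).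
- move=> v; rewrite /B0 ipDl ipZl ip_norm; apply/andP; split.
    by rewrite ler_wpDr// ler_wpM2r// sqr_ge0.
  rewrite mulrDl lerD//; first by rewrite ler_wpM2r// sqr_ge0.
  rewrite (le_trans (ler_norm _))// (le_trans (ip_le _ _))//.
  by rewrite expr2 mulrA ler_wpM2r.
Qed.

Lemma initial_bounds (e : R) : 0 < e -> exists m N : R, 0 < m /\ forall k,
  e <= `|gJ (x k.+1)| -> `|y k| <= L * `|s k| -> sym_bounds m N (B0 k.+1).
Proof.
move=> e0; have [T hT] := tau_upper e e0; have [MS MS0 hS] := S_norm.
have ce0 : 0 < c1 * e `^ c2 by rewrite mulr_gt0// powR_gt0.
move: c0_ge0; rewrite le_eqVlt => /orP[/eqP c00|c0_gt0].
- have [M0 hM0] := c0_eq0 (esym c00).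
  pose M := Num.max M0 1; pose T' := Num.max T 0.
  have M_gt0 : 0 < M by rewrite lt_max ltr01 orbT.
  have N_gt0 : 0 < T' + MS by rewrite ltr_wpDl// le_max lexx orbT.
  exists (M ^+ 2 * (T' + MS))^-1, (T' + MS); split.
    by rewrite invr_gt0 mulr_gt0// exprn_gt0.
  move=> k eg yL; apply: sym_psd_inverse_bound => //.
    apply: shifted_bounds => //; last by rewrite le_max hT.
    apply: le_trans (tau_lower k).
    by rewrite le_min -c00 lexx mulr_ge0 ?powR_ge0// ltW.
  move=> v; apply: le_trans (hM0 k.+1 (act k.+1) v) _.
  by rewrite ler_wpM2r// le_max lexx.
- exists (Num.min c0 (c1 * e `^ c2)), (T + MS); split.
    by rewrite lt_min c0_gt0.
  move=> k eg yL; apply: shifted_bounds => //.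
  + by rewrite le_min ltW//= ltW.
  + apply: le_trans (tau_lower k); rewrite le_min ge_min lexx /=.
    by rewrite ge_min le_powR// orbT.
  + exact: hT.
Qed.

Let B k := lbfgs_op ip cs (B0 k) s y (k - ell) k.

Let B_dir k : B k (d k) = - gJ (x k).
Proof. by have [_ /(_ k (act k))[]] := run. Qed.

Lemma operator_bounds (m N : R) : 0 < m -> exists m' N' : R, 0 < m' /\
  forall k, (forall j, (j < k)%N -> `|y j| <= L * `|s j|) ->
    sym_bounds m N (B0 k) -> sym_bounds m' N' (B k).
Proof.
move=> m0; have [m' [N' [m'0 h]]] := lbfgs_fold_bounds cs L cs_gt0 L_gt0 ell m N m0.
exists m', N'; split=> // k yL sB; apply: h => //.
  by rewrite size_iota leq_subCl.
move=> j; rewrite mem_iota => /andP[_ jk]; apply: yL.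
by rewrite (leq_trans jk)// subnKC// leq_subr.
Qed.

Let y_le k : Omega J (x 0) (x k) -> Omega J (x 0) (x k.+1) -> `|y k| <= L * `|s k|.
Proof.
move=> Ok Ok1; rewrite /y (le_trans (gJ_Lip _ _ Ok1 Ok))//.
by rewrite x_next addrAC subrr add0r.
Qed.

Let direction_bounds k (m N : R) : 0 < m -> sym_bounds m N (B k) ->
  m * `|d k| ^+ 2 <= - ip (gJ (x k)) (d k) /\
  `|gJ (x k)| ^+ 2 <= N * - ip (gJ (x k)) (d k).
Proof.
move=> m0 sB; have := sym_bounds_norm _ _ _ (d k) (ltW m0) sB.
rewrite B_dir normrN ipNl => h; split=> //.
by case: sB => _ _ /(_ (d k)) /andP[+ _]; rewrite B_dir ipNl.
Qed.

Lemma iterates_in_level_set k : Omega J (x 0) (x k) /\ J (x k.+1) <= J (x k).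
Proof.
elim/ltn_ind: k => k IH.
have Ok : Omega J (x 0) (x k).
  case: k IH => [|k] IH; first exact: lexx.
  by have [Ok ?] := IH k (ltnSn k); apply: le_trans Ok.
split=> //.
have yL j : (j < k)%N -> `|y j| <= L * `|s j|.
  move=> jk; have [Oj hj] := IH j jk.
  by apply: y_le => //; apply: le_trans Oj.
have [m [N [m0 sB0]]] : exists m N : R, 0 < m /\ sym_bounds m N (B0 k).
  case: k {IH Ok} yL => [|k] yL.
    have [MS MS0 hS] := S_norm; have [tau0 _] := run.
    by exists (tau 0), (tau 0 + MS); split=> //; apply: shifted_bounds => //; exact: ltW.
  have [m [N [m0 h]]] := initial_bounds `|gJ (x k.+1)| (le_lt_trans eps_ge0 (nonstop k)).
  by exists m, N; split=> //; apply: h => //; exact: yL.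
have [m' [N' [m'0 h]]] := operator_bounds m N m0.
have [h1 _] := direction_bounds k m' N' m'0 (h k yL sB0).
have [_ /(_ k (act k))[_ _ st _ _]] := run.
rewrite x_next; apply: step_nonincreasing st => //.
by rewrite -oppr_ge0 (le_trans _ h1)// mulr_ge0 ?sqr_ge0// ltW.
Qed.

Lemma uniform_decrease (e : R) : 0 < e -> exists2 c : R, 0 < c &
  forall k, e <= `|gJ (x k.+1)| -> J (x k.+2) <= J (x k.+1) - c.
Proof.
move=> e0; have [m [N [m0 h0]]] := initial_bounds e e0.
have [m' [N' [m'0 h]]] := operator_bounds m N m0.
have [c c_gt0 hc] := step_sufficient_decrease J gJ (x 0) L J_C1 L_gt0 gJ_Lip ls m' lsP m'0.
pose N1 := Num.max N' 1.
have N1_gt0 : 0 < N1 by rewrite lt_max ltr01 orbT.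
exists (c * (e ^+ 2 / N1)); first by rewrite mulr_gt0// divr_gt0// exprn_gt0.
move=> k eg.
have yL j : `|y j| <= L * `|s j|.
  by apply: y_le; [have [] := iterates_in_level_set j|have [] := iterates_in_level_set j.+1].
have [h1 h2] := direction_bounds k.+1 m' N' m'0
  (h k.+1 (fun j _ => yL j) (h0 k eg (yL k))).
have [_ /(_ k.+1 (act k.+1))[_ _ st _ _]] := run.
have [Ok _] := iterates_in_level_set k.+1.
set p := - ip (gJ (x k.+1)) (d k.+1) in h1 h2 hc *.
have p_ge0 : 0 <= p by rewrite (le_trans _ h1)// mulr_ge0 ?sqr_ge0// ltW.
have ep : e ^+ 2 / N1 <= p.
  rewrite ler_pdivrMr// mulrC (le_trans _ (_ : N' * p <= N1 * p))//.
    by rewrite (le_trans _ h2)// ler_pXn2r ?nnegrE// ltW.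
  by rewrite ler_wpM2r// le_max lexx.
have p_gt0 : 0 < p by rewrite (lt_le_trans _ ep)// divr_gt0// exprn_gt0.
have := hc _ _ _ Ok p_gt0 h1 st; rewrite -/(s k.+1) -x_next => /le_trans; apply.
by rewrite lerD2l lerN2 ler_wpM2l// ltW.
Qed.

Lemma gradient_to0 (e : R) : 0 < e ->
  exists N, forall k, (N <= k)%N -> `|gJ (x k)| < e.
Proof.
move=> e0; have [c c_gt0 hc] := uniform_decrease e e0.
have [b hb] := J_bounded.
pose A := [set J (x k) | k in [set: nat]].
have infA : has_inf A by split; [exists (J (x 0)), 0%N|exists b => _ [k _ <-]].
have [_ [N _ <-] JN] := inf_adherent c_gt0 infA.
exists N.+1 => -[//|k] Nk; rewrite ltNge; apply/negP => /hc h.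
have mono : {homo J \o x : i j / (i <= j)%N >-> j <= i}.
  apply: homo_leq => [i|i j l ij jl|i]; rewrite ?lexx//=.
    exact: le_trans jl ij.
  by have [] := iterates_in_level_set i.
have := mono N k.+1 (leqW Nk); rewrite /= => h1.
have : inf A <= J (x k.+2).
  by apply: ge_inf; [case: infA|exists k.+2].
by move=> h2; lra.
Qed.

End Run.

End Hilbert.

Theorem theorem4p8 (R : realType) (X : completeNormedModType R)
  (ip : X -> X -> R) (J : X -> R) (gJ : X -> X)
  (eps : R) (ell : nat) (c0 : R) (C0 : \bar R) (cs c1 c2 : R)
  (tau_g_variant : bool) (ls : line_search R) (L : R)
  (x : nat -> X) (tau : nat -> R) (S : nat -> X -> X) (d : nat -> X)
  (alpha : nat -> R) :
  inner_product ip ->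
  (* parameters *)
  0 <= eps -> 0 <= c0 -> (c0%:E <= C0)%E -> 0 < cs -> 0 < c1 -> 0 < c2 ->
  (* 1) *)
  C1_with_gradient ip J gJ ->
  (exists m : R, forall u, m <= J u) ->
  (* 2) *)
  0 < L ->
  (forall u v, Omega J (x 0) u -> Omega J (x 0) v ->
     `|gJ u - gJ v| <= L * `|u - v|) ->
  (* 3) *)
  (exists M : R, forall k, active gJ eps x k -> forall v, `|S k v| <= M * `|v|) ->
  (* 4) *)
  line_search_params ls ->
  (forall beta sigma, ls = Armijo_bt beta sigma ->
     exists2 delta : R, 0 < delta &
       unif_cont_on_R (Omega_delta J (x 0) delta) J \/
       unif_cont_on_X (Omega_delta J (x 0) delta) gJ) ->
  (* 5) *)
  (c0 = 0 -> exists M : R, forall k, active gJ eps x k ->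
     forall v, `|v| <= M * `|tau k *: v + S k v|) ->
  (* 6) *)
  (C0 = +oo%E ->
     tau_g_variant \/
     exists H : X -> X -> X,
       C2_with_hessian gJ H /\
       (forall k, active gJ eps x k.+1 ->
          let sk := alpha k *: d k in
          (forall v w, Gbar_form ip H (S k.+1) (x k) sk v w
                       = Gbar_form ip H (S k.+1) (x k) sk w v) /\
          (forall v, 0 <= Gbar_form ip H (S k.+1) (x k) sk v v)) /\
       (exists M : R, forall k, active gJ eps x k.+1 ->
          forall v w, `|Gbar_form ip H (S k.+1) (x k) (alpha k *: d k) v w|
                      <= M * `|v| * `|w|)) ->
  (* the run *)
  slbfgs_run ip J gJ eps ell c0 C0 cs c1 c2 tau_g_variant ls x tau S d alpha ->
  (eps = 0 ->
     (exists k, gJ (x k.+1) = 0) \/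
     [/\ forall k, gJ (x k.+1) <> 0,
         (fun k => `|gJ (x k)|) @ \oo --> (0 : R) &
         forall p : X,
           (forall e : R, 0 < e -> forall N, exists2 k, (N <= k)%N & `|x k - p| < e) ->
           gJ p = 0]) /\
  (0 < eps -> exists k, `|gJ (x k.+1)| <= eps).
Proof.
move=> ipP eps0 c00 c0C cs0 c10 c20 JC1 Jb L0 Lip Sb lsP _ c0P C0P run.
have conv : (forall k, eps < `|gJ (x k.+1)|) -> forall e : R, 0 < e ->
    exists N, forall k, (N <= k)%N -> `|gJ (x k)| < e.
  move=> nonstop; exact: (gradient_to0 ip ipP J gJ eps ell c0 C0 cs c1 c2
    tau_g_variant ls L x tau S d alpha eps0 c00 c0C cs0 c10 c20 JC1 Jb L0 Lip
    Sb lsP c0P C0P run nonstop).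
split=> [eE|eps_gt0]; last first.
  apply: contrapT => /forallNP nonstop.
  have [k|N hN] := conv _ eps eps_gt0.
    by rewrite ltNge; apply/negP; exact: nonstop.
  by apply: (nonstop N); rewrite ltW// hN.
have [|/forallNP g_neq0] := pselect (exists k, gJ (x k.+1) = 0); first by left.
right.
have cv : forall e : R, 0 < e -> exists N, forall k, (N <= k)%N -> `|gJ (x k)| < e.
  by apply: conv => k; rewrite eE normr_gt0; apply/eqP; exact: g_neq0.
split=> //.
  apply/cvgrPdist_lt => e e0; have [N hN] := cv e e0.
  by exists N => // k /= Nk; rewrite sub0r normrN normr_id hN.
move=> p clus; apply/eqP; rewrite -normr_eq0 eq_le normr_ge0 andbT leNgt.
apply/negP => gp; have gp2 : 0 < `|gJ p| / 2 by rewrite divr_gt0.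
have [_ cg] := JC1.
have /cvgrPdist_lt /(_ _ gp2) /nbhs_ballP[r /= r0 hr] : gJ @ p --> gJ p by exact: cg.
have [N hN] := cv _ gp2; have [k Nk xk] := clus r r0 N.
have h1 := hN k Nk.
have : `|gJ p - gJ (x k)| < `|gJ p| / 2.
  by apply: hr; rewrite -ball_normE /= distrC.
have := ler_normD (gJ p - gJ (x k)) (gJ (x k)); rewrite subrK => h2 h3.
lra.
Qed.
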